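(* Let $L:T^2M\to\mathbb{R}$ be a regular second order Lagrangian on a smooth $n$-dimensional manifold $M$, and let $t\in[0,1]\mapsto (x^i(t))$ be a smooth curve in a coordinate chart of $M$. For smooth functions $V^i:[0,1]\to\mathbb{R}$ with $V^i(0)=V^i(1)=0$ (the components of a vector field along the curve) and for $\varepsilon$ in a small neighborhood of $0\in\mathbb{R}$, put $$c_\varepsilon(t)=\left(x^i(t),\ \frac{dx^i}{dt}(t)+\varepsilon V^i(t),\ \frac12\frac{d^2x^i}{dt^2}(t)+\varepsilon\frac{dV^i}{dt}(t)\right)\in T^2M,\qquad I(c_\varepsilon)=\int_0^1L(c_\varepsilon(t))\,dt .$$ Then $\frac{d}{d\varepsilon}I(c_\varepsilon)\big|_{\varepsilon=0}=0$ for all such $V$ if and only if the Craig-Synge equations $$\frac{\partial L}{\partial y^{(1)i}}-\frac{d}{dt}\left(\frac{\partial L}{\partial y^{(2)i}}\right)=0,\qquad i=1,\dots,n,$$ hold along $c_0(t)=\left(x^i(t),\frac{dx^i}{dt}(t),\frac12\frac{d^2x^i}{dt^2}(t)\right)$.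
   Context: $T^2M$ is the second order tangent bundle (2-jets at $0$ of curves in $M$). A chart $(x^i)$ on $M$ induces coordinates $(x^i,y^{(1)i},y^{(2)i})$ on $T^2M$ by $y^{(\alpha)i}(j^2_0\rho)=\frac{1}{\alpha!}\frac{d^\alpha(x^i\circ\rho)}{dt^\alpha}\big|_{t=0}$, $\alpha=1,2$. A second order Lagrangian is a smooth function $L:T^2M\to\mathbb{R}$; it is regular if the matrix $\frac12\frac{\partial^2L}{\partial y^{(2)i}\partial y^{(2)j}}$ has rank $n$ everywhere on $T^2M$. *)

(* Defs.v *)
From HB Require Import structures.
From mathcomp Require Import all_boot all_order all_algebra.
From mathcomp Require Import all_classical all_reals all_analysis.

Set Implicit Arguments.
Unset Strict Implicit.
Unset Printing Implicit Defensive.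

Import Order.TTheory GRing.Theory Num.Theory.
Import numFieldNormedType.Exports.

Local Open Scope ring_scope.
Local Open Scope classical_set_scope.

(* C^k maps on an open subset U of a finite-dimensional space; for such U the
   values of f outside U are irrelevant. *)
Fixpoint Ck (R : realType) (V W : normedModType R) (k : nat) (U : set V)
    (f : V -> W) : Prop :=
  match k with
  | 0 => forall a, U a -> {for a, continuous f}
  | k'.+1 => (forall a, U a -> differentiable f a) /\
             (forall v, Ck k' U ('D_v f))
  end.

Definition smooth_on (R : realType) (V W : normedModType R) (U : set V)
    (f : V -> W) : Prop :=
  forall k, Ck k U f.

(* Smoothness on the closed interval [0,1] means, as usual, smoothness of some
   extension to an open neighbourhood; the total function f is that extension.
   Its derivatives at the end points are the one-sided derivatives of the
   restriction to [0,1]. *)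
Definition smooth_on01 (R : realType) (W : normedModType R) (f : R -> W) : Prop :=
  exists O : set R, [/\ open O, `[0, 1] `<=` O & smooth_on O f].

(* chart_map and chart_inv are total functions, meaningful on chart_dom and on
   the image of chart_dom respectively. *)
Record chart (R : realType) (n : nat) (M : topologicalType) := Chart {
  chart_dom : set M ;
  chart_map :> M -> 'rV[R]_n ;
  chart_inv : 'rV[R]_n -> M ;
  _ : open chart_dom ;
  _ : open (chart_map @` chart_dom) ;
  _ : forall p, chart_dom p -> chart_inv (chart_map p) = p ;
  _ : forall p, chart_dom p -> {for p, continuous chart_map} ;
  _ : forall u, (chart_map @` chart_dom) u -> {for u, continuous chart_inv}
}.

Definition chart_range (R : realType) (n : nat) (M : topologicalType)
    (c : chart R n M) : set 'rV[R]_n :=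
  c @` chart_dom c.

Lemma chart_range_open (R : realType) (n : nat) (M : topologicalType)
    (c : chart R n M) : open (chart_range c).
Proof. by case: c. Qed.

Lemma chart_invK (R : realType) (n : nat) (M : topologicalType)
    (c : chart R n M) (u : 'rV[R]_n) :
  chart_range c u -> c (chart_inv c u) = u /\ chart_dom c (chart_inv c u).
Proof.
by case: c => D f g oD oR K ? ? [p /= Dp <-]; rewrite K.
Qed.

Definition compatible (R : realType) (n : nat) (M : topologicalType)
    (c c' : chart R n M) : Prop :=
  smooth_on (c @` (chart_dom c `&` chart_dom c')) (c' \o chart_inv c) /\
  smooth_on (c' @` (chart_dom c `&` chart_dom c')) (c \o chart_inv c').

Record smooth_manifold (R : realType) (n : nat) := SmoothManifold {
  carrier :> topologicalType ;
  atlas : set (chart R n carrier) ;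
  _ : hausdorff_space carrier ;
  _ : @second_countable carrier ;
  _ : forall p : carrier, exists2 c, atlas c & chart_dom c p ;
  _ : forall c c', atlas c -> atlas c' -> compatible c c' ;
  _ : forall c, (forall c', atlas c' -> compatible c c') -> atlas c
}.

Lemma Ck_near_eq (R : realType) (W : normedModType R) (k : nat) (O : set R)
    (f g : R -> W) : open O -> (forall t, O t -> f t = g t) ->
  Ck k O g -> Ck k O f.
Proof.
move=> oO; elim: k f g => [|k IH] f g fg /=.
  move=> gC a Oa.
  have nfg : \near a, g a = f a.
    by apply: filterS (open_nbhs_nbhs (conj oO Oa)) => y /fg.
  by rewrite /prop_for /continuous_at fg//; exact: cvg_trans (near_eq_cvg nfg) (gC a Oa).
move=> [dg Dg]; split => [a Oa|v].
  apply/derivable1_diffP/(near_eq_derivable (f := g)).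
    by apply: filterS (open_nbhs_nbhs (conj oO Oa)) => y /fg.
  exact/derivable1_diffP/dg.
apply: (IH _ ('D_v g)) (Dg v) => t Ot; apply: near_eq_derive.
exact: filterS (open_nbhs_nbhs (conj oO Ot)).
Qed.

Section quad.
Context (R : realType) (n : nat).
Implicit Types a b d : 'rV[R]_n.

Definition quad a b d (t : R) : 'rV[R]_n := a + t *: b + t ^+ 2 *: d.

Lemma is_diff_quad a b d (t : R) :
  is_diff t (quad a b d) (fun h => h *: b + (2 * t * h) *: d).
Proof.
have h2 : is_diff t (@GRing.exp R ^~ 2) (2 * t ^+ 1 *: id).
  have -> : (@GRing.exp R ^~ 2) = (id : R -> R) ^+ 2 by apply/funext=> s; rewrite exprfctE.
  exact: is_diffX.
have h3 := is_diff_comp h2 (is_diff_scalel (t ^+ 2) d).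
have := is_diffD (is_diffD (is_diff_cst a t) (is_diff_scalel t b)) h3.
move=> [h e]; apply: DiffDef; first exact: h.
by rewrite [LHS]e; apply/funext => u; rewrite !fctE /= add0r expr1.
Qed.

Lemma quad_derive a b d v (t : R) :
  'D_v (quad a b d) t = v *: b + (2 * t * v) *: d.
Proof.
have [h e] := is_diff_quad a b d t.
by rewrite deriveE// e.
Qed.

Lemma quad_smooth (O : set R) a b d : smooth_on O (quad a b d).
Proof.
move=> k; elim: k a b d => [|k IH] a b d /=.
  move=> t _; apply: differentiable_continuous.
  by have [] := is_diff_quad a b d t.
split => [t _|v]; first by have [] := is_diff_quad a b d t.
have -> : 'D_v (quad a b d) = quad (v *: b) ((2 * v) *: d) 0.
  apply/funext => t; rewrite quad_derive /quad scaler0 addr0 scalerA.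
  by rewrite mulrAC mulrC.
exact: IH.
Qed.

End quad.

Section SecondOrderTangentBundle.
Context (R : realType) (n : nat) (M : smooth_manifold R n).

Definition smooth_at0 (rho : R -> M) : Prop :=
  exists2 c : chart R n M, atlas c &
  exists O : set R, [/\ open_nbhs 0 O, rho @` O `<=` chart_dom c &
                        smooth_on O (c \o rho)].

Record curve_at0 := CurveAt0 {
  curve_fun :> R -> M ;
  curve_smooth : smooth_at0 curve_fun
}.

(* The fibre coordinate y^(alpha) of the jet of rho. *)
Definition ycoord (c : chart R n M) (alpha : nat) (rho : R -> M) : 'rV[R]_n :=
  (alpha`!%:R)^-1 *: ((c \o rho)^`(alpha))%classic 0.

Definition same_jet2 (rho sigma : R -> M) : Prop :=
  rho 0 = sigma 0 /\
  forall c, atlas c -> chart_dom c (rho 0) ->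
    ycoord c 1 rho = ycoord c 1 sigma /\ ycoord c 2 rho = ycoord c 2 sigma.

(* Points of T^2 M are equivalence classes of same_jet2. *)
Record T2 := MkT2 {
  jet_class : set curve_at0 ;
  _ : exists rho : curve_at0,
        jet_class = [set sigma : curve_at0 | same_jet2 rho sigma]
}.

Definition jet2 (rho : curve_at0) : T2 :=
  @MkT2 [set sigma : curve_at0 | same_jet2 rho sigma]
        (ex_intro _ rho erefl).

(* Coordinates (x, y^(1), y^(2)) on T^2 M. *)
Local Notation coordT2 := ('rV[R]_n * 'rV[R]_n * 'rV[R]_n)%type.

Definition coords (c : chart R n M) (rho : R -> M) : coordT2 :=
  (c (rho 0), ycoord c 1 rho, ycoord c 2 rho).

Definition coord_dom (c : chart R n M) : set coordT2 :=
  [set p | chart_range c p.1.1].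

(* The curve whose expression in the chart c is t |-> x + t y1 + t^2 y2. *)
Definition model_curve (c : chart R n M) (p : coordT2) (t : R) : M :=
  chart_inv c (p.1.1 + t *: p.1.2 + t ^+ 2 *: p.2).

(* The expression of L in the coordinates induced by the chart c, that is
   L(x, y^(1), y^(2)) on coord_dom c (see coord_exprE below); its values elsewhere
   are irrelevant. *)
Definition coord_expr (L : T2 -> R) (c : chart R n M) (p : coordT2) : R :=
  if pselect (smooth_at0 (model_curve c p)) is left h
  then L (jet2 (CurveAt0 h)) else 0.

Section ModelCurve.
Context (c : chart R n M) (p : coordT2) (ac : atlas c) (cp : coord_dom c p).

Let q := quad p.1.1 p.1.2 p.2.
Let O := q @^-1` chart_range c.

Let oO : open_nbhs (0:R) O.
Proof.
split; last by rewrite /O /q /= /quad scale0r expr0n scale0r !addr0.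
have /continuousP : continuous q.
  by move=> t; exact: (@quad_smooth R n setT p.1.1 p.1.2 p.2 0%N).
by apply; exact: chart_range_open.
Qed.

Let cqE t : O t -> (c \o model_curve c p) t = q t.
Proof. by move=> /chart_invK[]. Qed.

Lemma model_curve_smooth : smooth_at0 (model_curve c p).
Proof.
exists c => //; exists O; split => //.
- by move=> _ [t Ot <-]; have [] := chart_invK Ot.
- by move=> k; apply: (Ck_near_eq (proj1 oO) cqE); exact: quad_smooth.
Qed.

Lemma coords_model_curve :
  chart_dom c (model_curve c p 0) /\ coords c (model_curve c p) = p.
Proof.
have O0 : O 0 := proj2 oO.
have [e0 d0] := chart_invK O0.
split; first exact: d0.
have e1 t : O t -> (c \o model_curve c p)^`()%classic t = p.1.2 + (2 * t) *: p.2.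
  move=> Ot; rewrite derive1E (@near_eq_derive _ _ _ _ q).
    by rewrite quad_derive scale1r mulr1.
  exact: filterS cqE (open_nbhs_nbhs (conj (proj1 oO) Ot)).
have e2 : (c \o model_curve c p)^`(2)%classic 0 = 2 *: p.2.
  rewrite derive1nS derive1n1 derive1E.
  rewrite (@near_eq_derive _ _ _ _ (quad p.1.2 (2 *: p.2) 0)).
    by rewrite quad_derive scaler0 addr0 scale1r.
  apply: filterS (open_nbhs_nbhs oO) => t /e1 ->.
  by rewrite /quad scaler0 addr0 scalerA mulrC.
rewrite /coords /ycoord e2 derive1n1 e1// mulr0 scale0r addr0 scalerA mulVf ?pnatr_eq0//.
rewrite -[c (model_curve _ _ _)]/((c \o model_curve c p) 0) cqE// /q /quad.
by rewrite scale0r expr0n scale0r !addr0 invr1 !scale1r; case: p => [[]].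
Unshelve. all: by end_near. Qed.

Lemma coord_exprE (L : T2 -> R) :
  exists rho : curve_at0,
    [/\ chart_dom c (rho 0), coords c rho = p & coord_expr L c p = L (jet2 rho)].
Proof.
rewrite /coord_expr; case: pselect => [h|/(_ model_curve_smooth)//].
by exists (CurveAt0 h); have [? ?] := coords_model_curve.
Qed.

End ModelCurve.

Definition smooth_lagrangian (L : T2 -> R) : Prop :=
  forall c, atlas c -> smooth_on (coord_dom c) (coord_expr L c).

Definition unit_y1 (i : 'I_n) : coordT2 := (0, delta_mx 0 i, 0).
Definition unit_y2 (i : 'I_n) : coordT2 := (0, 0, delta_mx 0 i).

Definition d_y1 (i : 'I_n) (F : coordT2 -> R) : coordT2 -> R := 'D_(unit_y1 i) F.
Definition d_y2 (i : 'I_n) (F : coordT2 -> R) : coordT2 -> R := 'D_(unit_y2 i) F.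

Definition lagrangian_metric (F : coordT2 -> R) (p : coordT2) : 'M[R]_n :=
  \matrix_(i, j) (2^-1 * d_y2 i (d_y2 j F) p).

Definition regular_lagrangian (L : T2 -> R) : Prop :=
  forall c, atlas c -> forall p, coord_dom c p ->
    \rank (lagrangian_metric (coord_expr L c) p) = n.

(* The coordinates of c_eps(t). *)
Definition varied_curve (x V : R -> 'rV[R]_n) (eps t : R) : coordT2 :=
  (x t, x^`()%classic t + eps *: V t, 2^-1 *: x^`(2)%classic t + eps *: V^`()%classic t).

Definition lifted_curve (x : R -> 'rV[R]_n) (t : R) : coordT2 :=
  (x t, x^`()%classic t, 2^-1 *: x^`(2)%classic t).

Definition action (L : T2 -> R) (c : chart R n M) (x V : R -> 'rV[R]_n)
    (eps : R) : R :=
  \int[lebesgue_measure]_(t in `[0, 1]) coord_expr L c (varied_curve x V eps t).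

Definition craig_synge (L : T2 -> R) (c : chart R n M) (x : R -> 'rV[R]_n)
    (i : 'I_n) (t : R) : R :=
  d_y1 i (coord_expr L c) (lifted_curve x t)
  - (fun s => d_y2 i (coord_expr L c) (lifted_curve x s))^`()%classic t.

End SecondOrderTangentBundle.

(* Main.v *)
Require Import Defs.
From HB Require Import structures.
From mathcomp Require Import all_boot all_order all_algebra.
From mathcomp Require Import all_classical all_reals all_analysis.
From mathcomp Require Import ring lra.

Set Implicit Arguments.
Unset Strict Implicit.
Unset Printing Implicit Defensive.

Import Order.TTheory GRing.Theory Num.Theory.
Import numFieldNormedType.Exports.

Local Open Scope ring_scope.
Local Open Scope classical_set_scope.

(* Write F for L in coordinates, c for the lifted curve and E_i for the left-hand
   side of the i-th Craig-Synge equation.  Differentiation under the integral sign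
   gives the derivative of the action at 0 as the integral of
   F_{y1 i} V^i + F_{y2 i} V'^i, which is E_i V^i + (F_{y2 i} V^i)'.  The last term
   integrates to 0 because V vanishes at the end points.  For the converse no bump
   function is needed: E_i itself is smooth along the curve, so that
   V = t (1 - t) E_i e_i is an admissible variation, and the integral of
   t (1 - t) E_i^2 vanishes only if E_i does. *)

(** * Closure properties of C^k and smooth maps *)

Section Ck_maps.
Context (R : realType).

Lemma Ck_subset (V W : normedModType R) (k : nat) (U U' : set V) (f : V -> W) :
  U' `<=` U -> Ck k U f -> Ck k U' f.
Proof.
move=> sU; elim: k f => [|k IH] f /=; first by move=> cf a /sU /cf.
by move=> [df Df]; split => [a /sU /df//|v]; exact: IH.
Qed.

Lemma CkW (V W : normedModType R) (k : nat) (U : set V) (f : V -> W) :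
  Ck k.+1 U f -> Ck k U f.
Proof.
elim: k f => [|k IH] f [df Df].
  by move=> a Ua; exact/differentiable_continuous/df.
by split=> // v; exact/IH/Df.
Qed.

Lemma smooth_on_derive (V W : normedModType R) (U : set V) (f : V -> W) (v : V) :
  smooth_on U f -> smooth_on U ('D_v f).
Proof. by move=> sf k; have [_ Df] := sf k.+1; exact: Df. Qed.

Lemma smooth_on_differentiable (V W : normedModType R) (U : set V) (f : V -> W) a :
  smooth_on U f -> U a -> differentiable f a.
Proof. by move=> sf Ua; have [df _] := sf 1%N; exact: df. Qed.

Lemma smooth_on_continuous (V W : normedModType R) (U : set V) (f : V -> W) a :
  smooth_on U f -> U a -> {for a, continuous f}.
Proof. by move=> /(_ 0%N) /=; apply. Qed.

Lemma smooth_on_derive1 (W : normedModType R) (O : set R) (f : R -> W) :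
  smooth_on O f -> smooth_on O f^`()%classic.
Proof.
move=> /(smooth_on_derive (1 : R)); congr smooth_on.
by apply/funext => t; rewrite derive1E.
Qed.

Section linear.
Context (W W' : normedModType R) (l : {linear W -> W'}).
Hypothesis cl : continuous l.

Lemma derive_linear_comp (V : normedModType R) (f : V -> W) a v : differentiable f a ->
  'D_v (l \o f) a = l ('D_v f a).
Proof.
move=> df; have dl : differentiable l (f a) by exact: linear_differentiable.
rewrite deriveE; last exact: differentiable_comp.
by rewrite diff_comp//= diff_lin// deriveE.
Qed.

(** Directional derivatives commute with [l], which gives an induction on [k]. The derivative
    formula is known only at points of [O]; since [O] is open, [Ck_near_eq] accepts this. Sums,
    products and compositions below follow the same scheme. *)
Lemma Ck_linear_comp k (O : set R) (f : R -> W) : open O ->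
  Ck k O f -> Ck k O (l \o f).
Proof.
move=> oO; elim: k f => [|k IH] f /=.
  by move=> cf a Oa; apply: continuous_comp; [exact: cf|exact: cl].
move=> [df Df]; split=> [a Oa|v].
  by apply: differentiable_comp; [exact: df|exact: linear_differentiable].
apply: (Ck_near_eq oO (g := l \o 'D_v f)); last exact/IH/Df.
by move=> t Ot; rewrite derive_linear_comp//; exact: df.
Qed.

End linear.

Lemma CkD k (W : normedModType R) (O : set R) (f g : R -> W) : open O ->
  Ck k O f -> Ck k O g -> Ck k O (f \+ g).
Proof.
move=> oO; elim: k f g => [|k IH] f g /=.
  by move=> cf cg a Oa; apply: cvgD; [exact: cf|exact: cg].
move=> [df Df] [dg Dg]; split=> [a Oa|v].
  by apply: differentiableD; [exact: df|exact: dg].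
apply: (Ck_near_eq oO (g := 'D_v f \+ 'D_v g)); last by apply: IH.
move=> t Ot; apply: deriveD; apply: diff_derivable; [exact: df|exact: dg].
Qed.

Lemma CkM k (O : set R) (f g : R -> R) : open O ->
  Ck k O f -> Ck k O g -> Ck k O (f \* g).
Proof.
move=> oO; elim: k f g => [|k IH] f g.
  by move=> cf cg a Oa; apply: cvgM; [exact: cf|exact: cg].
move=> Cf Cg; have [df Df] := Cf; have [dg Dg] := Cg; split=> [a Oa|v].
  by apply: differentiableM; [exact: df|exact: dg].
apply: (Ck_near_eq oO (g := (f \* 'D_v g) \+ (g \* 'D_v f))).
  move=> t Ot; apply: deriveM; apply: diff_derivable; [exact: df|exact: dg].
(* Leibniz' rule leaves [f] and [g] themselves beside the derivatives, so their order drops from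
   [k.+1] to [k] by [CkW]. *)
by apply: CkD => //; apply: IH; [exact: CkW|exact: Dg|exact: CkW|exact: Df].
Qed.

Lemma Ck_cst k (W : normedModType R) (O : set R) (w : W) : Ck k O (cst w : R -> W).
Proof.
elim: k w => [|k IH] w; first by move=> a _; exact: cst_continuous.
split=> [//|v]; rewrite (_ : 'D_v _ = cst 0)//.
by apply/funext => t; rewrite derive_cst.
Qed.

Lemma Ck_sum k (O : set R) (I : Type) (r : seq I) (f : I -> R -> R) : open O ->
  (forall i, Ck k O (f i)) -> Ck k O (fun t => \sum_(i <- r) f i t).
Proof.
move=> oO Cf; elim: r => [|i r IH].
  rewrite (_ : (fun _ => _) = cst 0); first exact: Ck_cst.
  by apply/funext => t; rewrite big_nil.
rewrite (_ : (fun _ => _) = f i \+ (fun t => \sum_(i <- r) f i t)).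
  exact: CkD.
by apply/funext => t; rewrite big_cons.
Qed.

Lemma Ck_id k (O : set R) : Ck k O (id : R -> R).
Proof.
case: k => [|k]; first by move=> a _; exact: cvg_id.
split=> [//|v]; rewrite (_ : 'D_v _ = cst v); first exact: Ck_cst.
by apply/funext => t; rewrite derive_id.
Qed.

Lemma Ck_coord k n (O : set R) (f : R -> 'rV[R]_n) (i : 'I_n) : open O ->
  Ck k O f -> Ck k O (fun t => f t 0 i).
Proof.
move=> oO Cf.
(* [have @l] keeps the construction transparent, so that [l] still unfolds to the entry map. *)
have @l : {linear 'rV[R]_n -> R}.
  by exists (fun N : 'rV[R]_n => N 0 i); do 2![eexists]; do ?[constructor];
     rewrite ?mxE// => ? *; rewrite ?mxE//; move=> ?; rewrite !mxE.
by apply: (@Ck_linear_comp _ _ l) Cf => //; exact: coord_continuous.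
Qed.

Lemma Ck_scalel k (W : normedModType R) (O : set R) (f : R -> R) (w : W) : open O ->
  Ck k O f -> Ck k O (fun t => f t *: w).
Proof.
move=> oO Cf.
have lin : linear ( *:%R ^~ w : R -> W).
  by move=> a y z; rewrite scalerDl scalerA.
pose l : {linear R -> W} := HB.pack ( *:%R ^~ w) (GRing.isLinear.Build _ _ _ _ _ lin).
by apply: (@Ck_linear_comp _ _ l) Cf => //; exact: scalel_continuous.
Qed.

Lemma Ck_scaler k (W : normedModType R) (O : set R) (c : R) (f : R -> W) : open O ->
  Ck k O f -> Ck k O (fun t => c *: f t).
Proof.
move=> oO Cf; apply: (Ck_linear_comp (l := ( *:%R c : {linear W -> W})) _ oO Cf).
exact: scaler_continuous.
Qed.

End Ck_maps.

(** * Integrals of continuous functions over a segment *)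

Section interval_integrals.
Context (R : realType) (a b : R).
Hypothesis ab : a < b.
Local Notation mu := (@lebesgue_measure R).

Lemma within_continuous_pointwise (T U : topologicalType) (A : set T) (f : T -> U) :
  (forall t, A t -> {for t, continuous f}) -> {within A, continuous f}.
Proof. by move=> cf; apply: continuous_in_subspaceT => t /set_mem /cf. Qed.

Lemma segment_integrable (f : R -> R) :
  (forall t, `[a, b] t -> {for t, continuous f}) ->
  mu.-integrable `[a, b] (EFin \o f).
Proof.
move=> cf; apply: continuous_compact_integrable; first exact: segment_compact.
exact: within_continuous_pointwise.
Qed.

(** Continuity and differentiability are two-sided even at [a] and [b], as for functions smooth on a
    neighbourhood of the segment. The one-sided end point conditions of [continuous_FTC2] then
    follow at once. *)
Lemma Rintegral_FTC2 (F f : R -> R) :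
  (forall t, `[a, b] t -> {for t, continuous f}) ->
  (forall t, `[a, b] t -> is_derive t 1 F (f t)) ->
  \int[mu]_(t in `[a, b]) f t = F b - F a.
Proof.
move=> cf dF.
have cF t : `[a, b] t -> {for t, continuous F}.
  by move=> /dF[df _]; apply/differentiable_continuous/derivable1_diffP.
have aI : `[a, b] a by rewrite /= in_itv/= lexx ltW.
have bI : `[a, b] b by rewrite /= in_itv/= lexx ltW.
rewrite /Rintegral (@continuous_FTC2 _ f F)//.
- exact: within_continuous_pointwise.
- split.
  + by move=> t /subset_itv_oo_cc /dF[].
  + by apply: cvg_at_right_filter; exact: cF.
  + by apply: cvg_at_left_filter; exact: cF.
- by move=> t /subset_itv_oo_cc /dF[_ <-]; rewrite derive1E.
Qed.

(** If [f t] were positive at an interior point, [f] would exceed [f t / 2] on an interval [J] of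
    length [e] around [t], and the integral would be at least [e * (f t / 2)]. *)
Lemma Rintegral_eq0_continuous (f : R -> R) :
  (forall t, `[a, b] t -> {for t, continuous f}) ->
  (forall t, `[a, b] t -> 0 <= f t) ->
  \int[mu]_(t in `[a, b]) f t = 0 ->
  forall t, t \in `]a, b[%R -> f t = 0.
Proof.
move=> cf f0 int0 t tab; apply/eqP/negPn/negP => ft0.
have It := subset_itv_oo_cc tab.
have ftgt0 : 0 < f t / 2 by rewrite divr_gt0// lt_neqAle eq_sym ft0 f0.
have : \forall s \near t, f t / 2 < f s /\ s \in `]a, b[%R.
  near=> s; split; near: s; last exact: near_in_itvoo.
  by apply: (cvgr_gt (f t)); [exact: cf|rewrite ltr_pdivrMr// ltr_pMr// ?ltr1n//; lra].
move=> /nbhs_ballP[e /= e0 be].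
(* Half the radius keeps the closed interval inside the open ball. *)
pose J : set R := `[t - e / 2, t + e / 2].
have sub : J `<=` ball t e.
  move=> s; rewrite /J/= in_itv/= => /andP[s1 s2]; rewrite /ball/= ltr_distl.
  by apply/andP; split; lra.
have mJ : measurable J by exact: measurable_itv.
have subI : J `<=` `[a, b].
  by move=> s /sub /be[_ /subset_itv_oo_cc].
have intf := segment_integrable cf.
(* [Rintegral] is [fine] of the extended integral, and [fine] sends infinite values to 0.
   Integrability excludes this case. *)
have intE : (\int[mu]_(s in `[a, b]) (f s)%:E = 0)%E.
  rewrite -[LHS]fineK; last exact: integrable_fin_num.
  by rewrite -/(Rintegral _ _ _) int0.
have : (\int[mu]_(s in J) (f t / 2)%:E <= 0)%E.
  rewrite -intE; apply: (@le_trans _ _ (\int[mu]_(s in J) (f s)%:E)%E).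
    apply: ge0_le_integral => //=.
    - by move=> s _; rewrite lee_fin ltW.
    - apply: (measurable_funS _ subI) => //.
      exact: (measurable_int mu).
    - by move=> s /sub /be[/ltW]; rewrite lee_fin.
  apply: ge0_subset_integral => //=.
    exact: (measurable_int mu).
apply/negP; rewrite -ltNge integral_cst//= lebesgue_measure_itv/= lte_fin.
rewrite ifT; last by lra.
by rewrite -EFinD -EFinM lte_fin mulr_gt0//; lra.
Unshelve. all: by end_near. Qed.

(** Dominated differentiation under the integral sign. The joint continuity of [h] supplies the
    dominating function: a constant, the maximum of [|h|] over a compact rectangle. *)
Lemma is_derive_Rintegral (f h : R -> R -> R) (e0 : R) :
  (forall e t : R, `[a, b] t -> is_derive e 1 (f ^~ t) (h e t)) ->
  (forall e t : R, `[a, b] t -> {for t, continuous (f e)}) ->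
  (forall e t : R, `[a, b] t -> {for (e, t), continuous (fun p => h p.1 p.2)}) ->
  is_derive e0 1 (fun e => \int[mu]_(t in `[a, b]) f e t)
    (\int[mu]_(t in `[a, b]) h e0 t).
Proof.
move=> df cf ch.
have hE e t : `[a, b] t -> partial1of2 f e t = h e t.
  by move=> /(df e)[_ <-]; rewrite partial1of2E.
(* Differentiation at [e0] is local in [e], so any bounded neighbourhood will do; radius 1 is an
   arbitrary choice. *)
pose K : set (R * R) := `[e0 - 1, e0 + 1] `*` `[a, b].
have [p _ hp] : exists2 p, p \in K &
    forall q, q \in K -> `|h q.1 q.2| <= `|h p.1 p.2|.
  apply: (@compact_EVT_max _ R (fun p => `|h p.1 p.2|)).
  - exists (e0, a); split; rewrite /= in_itv/=.
      by rewrite lerBlDr !lerDl ler01.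
    by rewrite lexx ltW.
  - by apply: compact_setX; exact: segment_compact.
  - apply: within_continuous_pointwise => -[e t] [_ /= It].
    by apply: cvg_norm; exact: ch.
have e0I : `]e0 - 1, e0 + 1[ e0 by rewrite /= in_itv/=; apply/andP; split; lra.
have bnd e t : `]e0 - 1, e0 + 1[ e -> `[a, b] t ->
    `|partial1of2 f e t| <= `|h p.1 p.2|.
  move=> Ie It; rewrite hE//; apply: (hp (e, t)); rewrite inE; split=> //=.
  exact: subset_itv_oo_cc.
have intf e : mu.-integrable `[a, b] (EFin \o f e).
  by apply: segment_integrable => t; exact: cf.
have intc : mu.-integrable `[a, b] (EFin \o cst `|h p.1 p.2|).
  by apply: segment_integrable => t _; exact: cst_continuous.
have der e t : `]e0 - 1, e0 + 1[ e -> `[a, b] t -> derivable (f^~ t) e 1.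
  by move=> _ /(df e)[].
have G0 (t : R) : 0 <= (cst `|h p.1 p.2| : R -> R) t by [].
have := @derivable_under_integral R _ _ mu f _ (measurable_itv `[a, b]%R) _ _ _ e0I 
  (fun e _ => intf e) der _ G0 intc bnd.
have := @differentiation_under_integral R _ _ mu f _ (measurable_itv `[a, b]%R) _ _ _
  e0I (fun e _ => intf e) der _ G0 intc bnd.
rewrite derive1E => dE dI; apply: DeriveDef; first exact: dI.
by rewrite dE; apply: eq_Rintegral => t /set_mem It; exact: hE.
Qed.

End interval_integrals.

(** * Chain rule on the coordinate space of the second order tangent bundle *)

Section coordinate_maps.
Context (R : realType) (n : nat).
Local Notation rV := 'rV[R]_n.
Local Notation E := (rV * rV * rV)%type.

Lemma derive_comp_curve (V W : normedModType R) (F : V -> W) (g : R -> V) (t v : R) :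
  differentiable g t -> differentiable F (g t) ->
  'D_v (F \o g) t = 'D_('D_v g t) F (g t).
Proof.
move=> dg dF; rewrite [LHS]deriveE; last exact: differentiable_comp.
by rewrite diff_comp//= -(deriveE _ dg) -deriveE.
Qed.

Lemma derive_pair (V W W' : normedModType R) (f : V -> W) (g : V -> W') a v :
  differentiable f a -> differentiable g a ->
  'D_v (fun t => (f t, g t)) a = ('D_v f a, 'D_v g a).
Proof.
move=> df dg; rewrite deriveE; last exact: differentiable_pair.
by rewrite diff_pair// !deriveE.
Qed.

(** The differential is linear, and the direction is a combination of the basis vectors of the three
    blocks x, y1, y2. *)
Lemma derive_coordE (F : E -> R) (p : E) (u v w : rV) : differentiable F p ->
  'D_(u, v, w) F p = \sum_i (u 0 i * 'D_(delta_mx 0 i, 0, 0) F p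
    + v 0 i * d_y1 i F p + w 0 i * d_y2 i F p).
Proof.
move=> dF.
have -> : (u, v, w) = \sum_i (u 0 i *: ((delta_mx 0 i, 0, 0) : E)
    + v 0 i *: unit_y1 R i + w 0 i *: unit_y2 R i).
  rewrite {1}(row_sum_delta u) {1}(row_sum_delta v) {1}(row_sum_delta w).
  elim: (index_enum _) => [|i r IH]; first by rewrite !big_nil.
  rewrite !big_cons -IH /unit_y1 /unit_y2; congr (_, _, _);
    by rewrite /= !scaler0 !(addr0, add0r).
rewrite deriveE// raddf_sum; apply: eq_bigr => i _.
by rewrite raddfD/= raddfD/= !linearZ/= /d_y1 /d_y2 !deriveE.
Qed.

Lemma continuous_comp3 (T : topologicalType) (F : E -> R) (a b d : T -> rV) (t : T) :
  {for t, continuous a} -> {for t, continuous b} -> {for t, continuous d} ->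
  {for (a t, b t, d t), continuous F} ->
  {for t, continuous (fun s => F (a s, b s, d s))}.
Proof.
move=> ca cb cd cF.
suff cg : {for t, continuous (fun s => (a s, b s, d s))}.
  exact: (continuous_comp cg cF).
have cab : {for t, continuous (fun s => (a s, b s))}.
  exact: (@cvg_pair _ _ _ (nbhs t) (nbhs (a t)) (nbhs (b t)) _ _ _ a b ca cb).
exact: (@cvg_pair _ _ _ (nbhs t) (nbhs (a t, b t)) (nbhs (d t)) _ _ _ _ d cab cd).
Qed.

Lemma derive_comp3 (F : E -> R) (a b d : R -> rV) (t v : R) :
  differentiable a t -> differentiable b t -> differentiable d t ->
  differentiable F (a t, b t, d t) ->
  'D_v (fun s => F (a s, b s, d s)) t =
  'D_('D_v a t, 'D_v b t, 'D_v d t) F (a t, b t, d t).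
Proof.
move=> da db dd dF.
have dab : differentiable (fun s => (a s, b s)) t by exact: differentiable_pair.
have dabd : differentiable (fun s => (a s, b s, d s)) t by exact: differentiable_pair.
have e1 := derive_pair v da db; have e2 := derive_pair v dab dd.
by have := derive_comp_curve v dabd dF; rewrite e2 e1.
Qed.

(** The induction on [k] must let [F] vary, because the chain rule replaces it by its directional
    derivatives. Taking [F] smooth, not merely of order [k], keeps these within the hypotheses. *)
Lemma Ck_comp3 k (U : set E) (O : set R) (F : E -> R) (a b d : R -> rV) :
  open O -> smooth_on U F -> Ck k O a -> Ck k O b -> Ck k O d ->
  (forall t, O t -> U (a t, b t, d t)) ->
  Ck k O (fun t => F (a t, b t, d t)).
Proof.
move=> oO; elim: k F a b d => [|k IH] F a b d sF Ca Cb Cd OU.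
  move=> t Ot; apply: continuous_comp3; [exact: Ca|exact: Cb|exact: Cd|].
  exact/(smooth_on_continuous sF)/OU.
have [da Da] := Ca; have [db Db] := Cb; have [dd Dd] := Cd; split.
  move=> t Ot; apply: (@differentiable_comp _ _ _ _ (fun s => (a s, b s, d s)) F).
    apply: differentiable_pair; last exact: dd.
    by apply: differentiable_pair; [exact: da|exact: db].
  exact/(smooth_on_differentiable sF)/OU.
move=> v; apply: (Ck_near_eq oO (g := fun t => \sum_i (
    'D_v a t 0 i * 'D_(delta_mx 0 i, 0, 0) F (a t, b t, d t)
    + 'D_v b t 0 i * d_y1 i F (a t, b t, d t)
    + 'D_v d t 0 i * d_y2 i F (a t, b t, d t)))).
  move=> t Ot; have dF := smooth_on_differentiable sF (OU _ Ot).
  by rewrite derive_comp3 ?derive_coordE//; [exact: da|exact: db|exact: dd].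
apply: Ck_sum => // i.
have C w : Ck k O (fun t => 'D_w F (a t, b t, d t)).
  by apply: (IH ('D_w F) a b d); [exact: smooth_on_derive|exact: CkW|exact: CkW|exact: CkW|].
apply: CkD => //; first apply: CkD => //.
- by apply: CkM => //; apply: Ck_coord => //; exact: Da.
- by apply: CkM => //; [apply: Ck_coord => //; exact: Db|exact: C].
- by apply: CkM => //; [apply: Ck_coord => //; exact: Dd|exact: C].
Qed.

End coordinate_maps.

(** The value at an end point is a one-sided limit of zeros. This recovers the end points of [0,1],
    where the weight t (1 - t) vanishes and gives no information. *)
Lemma continuous_eq0_itvoo_cc (R : realType) (a b : R) (f : R -> R) : a < b ->
  (forall t, `[a, b] t -> {for t, continuous f}) ->
  (forall t, t \in `]a, b[%R -> f t = 0) ->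
  forall t, `[a, b] t -> f t = 0.
Proof.
move=> ab cf f0 t; rewrite /= in_itv/= => /andP[].
have aI : `[a, b] a by rewrite /= in_itv/= lexx ltW.
have bI : `[a, b] b by rewrite /= in_itv/= lexx ltW.
rewrite le_eqVlt => /predU1P[<- _|at_].
  have /cvg_at_right_filter c1 := cf _ aI.
  have c2 : f s @[s --> a^'+] --> (0 : R).
    apply: cvg_near_cst; near=> s; apply: f0; rewrite in_itv/=; apply/andP; split.
      by near: s; exact: nbhs_right_gt.
    by near: s; exact: nbhs_right_lt.
  exact: (cvg_unique _ c1 c2).
rewrite le_eqVlt => /predU1P[->|tb]; last by apply: f0; rewrite in_itv/= at_.
have /cvg_at_left_filter c1 := cf _ bI.
have c2 : f s @[s --> b^'-] --> (0 : R).
  apply: cvg_near_cst; near=> s; apply: f0; rewrite in_itv/=; apply/andP; split.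
    by near: s; exact: nbhs_left_gt.
  by near: s; exact: nbhs_left_lt.
exact: (cvg_unique _ c1 c2).
Unshelve. all: by end_near. Qed.

(** * The first variation formula in coordinates *)

Section first_variation.
Context (R : realType) (n : nat).
Local Notation rV := 'rV[R]_n.
Local Notation E := (rV * rV * rV)%type.
Context (D : set rV) (F : E -> R) (O : set R) (x : R -> rV).
Hypotheses (sF : smooth_on [set p : E | D p.1.1] F) (oO : open O)
  (IO : `[0, 1] `<=` O) (sx : smooth_on O x) (xD : forall t, O t -> D (x t)).
Local Notation mu := (@lebesgue_measure R).

(** Convertible to [craig_synge] when [F] is [coord_expr L c]; a general [F] keeps the manifold out
    of this section. *)
Definition craig_synge_of (i : 'I_n) (t : R) : R :=
  d_y1 i F (lifted_curve x t)
  - (fun s => d_y2 i F (lifted_curve x s))^`()%classic t.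

Lemma smooth_on_lifted (G : E -> R) : smooth_on [set p : E | D p.1.1] G ->
  smooth_on O (fun t => G (lifted_curve x t)).
Proof.
move=> sG k; apply: (Ck_comp3 oO sG) xD; first exact: sx.
  exact: smooth_on_derive1.
apply: Ck_scaler => //; rewrite derive1nS derive1n1.
by do 2 apply: smooth_on_derive1.
Qed.

Lemma smooth_on_craig_synge (i : 'I_n) : smooth_on O (craig_synge_of i).
Proof.
move=> k.
have -> : craig_synge_of i = (fun t => d_y1 i F (lifted_curve x t)) \+
    (fun t => -1 *: (fun s => d_y2 i F (lifted_curve x s))^`()%classic t).
  by apply/funext => t; rewrite /craig_synge_of /= scaleN1r.
apply: CkD => //.
  by apply: smooth_on_lifted; exact: smooth_on_derive.
apply: Ck_scaler => //.
by apply: smooth_on_derive1; apply: smooth_on_lifted; exact: smooth_on_derive.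
Qed.

Section variation.
Context (V : R -> rV).
Hypotheses (sV : smooth_on O V).

(** The derivative in [e] of the integrand. The variation leaves the x component fixed, hence no
    x-derivative of [F] occurs. *)
Let h (e t : R) : R := \sum_i (V t 0 i * d_y1 i F (varied_curve x V e t)
  + V^`()%classic t 0 i * d_y2 i F (varied_curve x V e t)).

(** The boundary term of the integration by parts. *)
Let G (t : R) : R := \sum_i d_y2 i F (lifted_curve x t) * V t 0 i.

Lemma varied_curve0 : varied_curve x V 0 = lifted_curve x.
Proof. by apply/funext => t; rewrite /varied_curve !scale0r !addr0. Qed.

(** The domain constrains only the x component, which is not varied, so the varied curve stays
    inside it for every [e], not only for small ones. *)
Lemma continuous_varied (H : E -> R) e t : smooth_on [set p : E | D p.1.1] H -> O t ->
  {for (e, t), continuous (fun p => H (varied_curve x V p.1 p.2))}.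
Proof.
move=> sH Ot.
have c2 (g : R -> rV) : smooth_on O g -> {for (e, t), continuous (g \o snd)}.
  move=> sg; apply: continuous_comp; first exact: cvg_snd.
  exact: (smooth_on_continuous sg).
have aff (k : R) (f g : R -> rV) : smooth_on O f -> smooth_on O g ->
    {for (e, t), continuous (fun p : R * R => k *: f p.2 + p.1 *: g p.2)}.
  move=> sf sg; apply: cvgD; first by apply: cvgZl_tmp; exact: c2.
  by apply: cvgZ; [exact: cvg_fst|exact: c2].
have sx1 := smooth_on_derive1 sx.
have sV1 := smooth_on_derive1 sV.
apply: continuous_comp3; first exact: c2.
(* The factor 1 brings this component to the form treated by [aff]. *)
- have -> : (fun p : R * R => x^`()%classic p.2 + p.1 *: V p.2) =
      (fun p => 1 *: x^`()%classic p.2 + p.1 *: V p.2).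
    by apply/funext => p; rewrite scale1r.
  exact: aff.
- apply: aff => //; exact: smooth_on_derive1 sx1.
- by apply: (smooth_on_continuous sH); exact: xD.
Qed.

Lemma is_derive_affine (p q : rV) (e : R) : is_derive e 1 (fun s => p + s *: q) q.
Proof.
have -> : (fun s => p + s *: q) = quad p q 0.
  by apply/funext => s; rewrite /quad scaler0 addr0.
have [d _] := is_diff_quad p q 0 e.
by apply: DeriveDef; [exact: diff_derivable|rewrite quad_derive scaler0 addr0 scale1r].
Qed.

Lemma is_derive_varied (e t : R) : O t ->
  is_derive e 1 (fun s => F (varied_curve x V s t)) (h e t).
Proof.
move=> Ot; have dF := smooth_on_differentiable sF (xD Ot : [set p : E | D p.1.1] (varied_curve x V e t)).
have [db eb] := is_derive_affine (x^`()%classic t) (V t) e.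
have [dd ed] := is_derive_affine (2^-1 *: x^`(2)%classic t) (V^`()%classic t) e.
move/derivable1_diffP : db => db; move/derivable1_diffP : dd => dd.
have da : differentiable (cst (x t) : R -> rV) e by [].
have dab := differentiable_pair da db.
have dabd := differentiable_pair dab dd.
apply: DeriveDef.
  apply: diff_derivable; exact: (differentiable_comp dabd dF).
have := derive_comp3 1 da db dd dF; rewrite eb ed derive_cst derive_coordE// => ->.
(* The x component is constant in [e], so its terms in [derive_coordE] carry the factor 0. *)
by apply: eq_bigr => i _; rewrite mxE mul0r add0r.
Qed.

Lemma smooth_on_boundary : smooth_on O G.
Proof.
move=> k; apply: Ck_sum => // i; apply: CkM => //.
  by apply: smooth_on_lifted; exact: smooth_on_derive.
by apply: Ck_coord => //; exact: sV.
Qed.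

(** The product rule for each F_{y2 i} V^i, read as an expression for F_{y2 i} V'^i. *)
Lemma integrand_by_parts t : O t ->
  h 0 t = \sum_i craig_synge_of i t * V t 0 i + G^`()%classic t.
Proof.
move=> Ot.
have dV : derivable V t 1 by apply/derivable1_diffP/(smooth_on_differentiable sV).
have dVi (i : 'I_n) : derivable (fun s => V s 0 i) t 1.
  by move/derivable_mxP : dV => /(_ 0 i).
have dP (i : 'I_n) : derivable (fun s => d_y2 i F (lifted_curve x s)) t 1.
  apply/derivable1_diffP/(smooth_on_differentiable _ Ot).
  by apply: smooth_on_lifted; exact: smooth_on_derive.
have -> : G = \sum_(i < n) (fun s => d_y2 i F (lifted_curve x s) * V s 0 i).
  by apply/funext => s; rewrite fct_sumE.
rewrite derive1E derive_sum; last by move=> i; exact: derivableM.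
rewrite -big_split/=; apply: eq_bigr => i _.
rewrite deriveM// /craig_synge_of varied_curve0 !derive1E derive_mx// mxE.
rewrite /GRing.scale/=; ring.
Qed.

Lemma first_variation : V 0 = 0 -> V 1 = 0 ->
  is_derive (0 : R) 1
    (fun e => \int[mu]_(t in `[0, 1]) F (varied_curve x V e t))
    (\int[mu]_(t in `[0, 1]) \sum_i craig_synge_of i t * V t 0 i).
Proof.
move=> V0 V1.
have cS (t : R) : `[0, 1] t ->
    {for t, continuous (fun s => \sum_i craig_synge_of i s * V s 0 i)}.
  move=> /IO Ot; apply: (smooth_on_continuous _ Ot) => k.
  apply: Ck_sum => // i; apply: CkM => //; first exact: smooth_on_craig_synge.
  by apply: Ck_coord => //; exact: sV.
have cG (t : R) : `[0, 1] t -> {for t, continuous G^`()%classic}.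
  by move=> /IO Ot; apply: (smooth_on_continuous _ Ot); exact/smooth_on_derive1/smooth_on_boundary.
have intG : \int[mu]_(t in `[0, 1]) G^`()%classic t = 0.
  have dG (t : R) : `[0, 1] t -> is_derive t 1 G (G^`()%classic t).
    move=> /IO Ot; rewrite derive1E; apply: derivableP.
    exact/derivable1_diffP/(smooth_on_differentiable smooth_on_boundary).
  have G0 t : V t = 0 -> G t = 0.
    by move=> Vt0; apply: big1 => i _; rewrite Vt0 mxE mulr0.
  by rewrite (Rintegral_FTC2 ltr01 cG dG) G0// G0// subrr.
(* The claimed value is exchanged for the integral of [h 0], the form in which differentiation under
   the integral sign delivers it. *)
have -> : \int[mu]_(t in `[0, 1]) (\sum_i craig_synge_of i t * V t 0 i) =
    \int[mu]_(t in `[0, 1]) h 0 t.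
  under [RHS]eq_Rintegral => t /set_mem /IO Ot do rewrite integrand_by_parts//.
  rewrite RintegralD//; first by rewrite intG addr0.
    exact: segment_integrable.
  exact: segment_integrable.
apply: (is_derive_Rintegral ltr01).
- by move=> e t /IO; exact: is_derive_varied.
- move=> e t /IO Ot.
  (* Restricting to the slice of constant [e] turns joint continuity into continuity in [t]. *)
  have c2 : {for t, continuous (fun s : R => (e, s))}.
    exact: (@cvg_pair _ _ _ (nbhs t) (nbhs e) (nbhs t) _ _ _ _ _ (cvg_cst e) cvg_id).
  exact: (continuous_comp c2 (continuous_varied sF Ot)).
- move=> e t /IO Ot.
  have cV (g : R -> rV) (i : 'I_n) : smooth_on O g ->
      {for (e, t), continuous (fun p : R * R => g p.2 0 i)}.
    move=> sg; apply: (@continuous_comp _ _ _ snd (fun s => g s 0 i)).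
      exact: cvg_snd.
    apply: (smooth_on_continuous _ Ot) => k; apply: Ck_coord => //; exact: sg.
  rewrite /h; apply: cvg_big => [|i _]; first exact: add_continuous.
  apply: cvgD; apply: cvgM.
  + exact: cV.
  + exact/continuous_varied/Ot/smooth_on_derive.
  + exact/cV/smooth_on_derive1.
  + exact/continuous_varied/Ot/smooth_on_derive.
Qed.

End variation.

End first_variation.

(** [is_derive] asserts that the derivative exists as well as its value; from right to left,
    existence comes from [first_variation]. *)
Theorem mainTheorem3 (R : realType) (n : nat) (M : smooth_manifold R n)
    (L : T2 M -> R) (L_smooth : smooth_lagrangian L)
    (L_regular : regular_lagrangian L)
    (c : chart R n M) (c_chart : @atlas R n M c)
    (x : R -> 'rV[R]_n) (x_smooth : smooth_on01 x)
    (x_in_chart : forall t : R, `[0, 1] t -> chart_range c (x t)) :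
  (forall V : R -> 'rV[R]_n, smooth_on01 V -> V 0 = 0 -> V 1 = 0 ->
     is_derive (0 : R) 1 (action L c x V) 0) <->
  (forall (i : 'I_n) (t : R), `[0, 1] t -> craig_synge L c x i t = 0).
Proof.
have [U0 [oU0 IU0 sx0]] := x_smooth.
(* The extension of [x] may leave the chart outside [0,1]; [O] keeps only the times at which it does
   not, and is open because [x] is continuous on [U0]. *)
pose O := U0 `&` x @^-1` chart_range c.
have sO : O `<=` U0 by apply: subIsetl.
have oO : open O.
  rewrite openE => t [U0t Dt]; apply: filterI; first exact: open_nbhs_nbhs.
  apply: (smooth_on_continuous sx0 U0t); apply: open_nbhs_nbhs.
  by split=> //; exact: chart_range_open.
have IO : `[0, 1] `<=` O by move=> t It; split; [exact: IU0|exact: x_in_chart].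
have sx : smooth_on O x by move=> k; exact: Ck_subset sO (sx0 k).
have xD t : O t -> chart_range c (x t) by case.
have sF : smooth_on [set p | chart_range c p.1.1] (coord_expr L c) := L_smooth c c_chart.
split=> [dI i|CS V [U1 [oU1 IU1 sV1]] V0 V1].
- pose EL := craig_synge_of (coord_expr L c) x i.
  have sEL : smooth_on O EL := smooth_on_craig_synge sF oO sx xD i.
  have sW : smooth_on O (fun s => s * (1 - s) * EL s).
    move=> k; apply: CkM => //; apply: CkM => //; first exact: Ck_id.
    have -> : (fun s : R => 1 - s) = cst 1 \+ (fun s => -1 *: s).
      by apply/funext => s; rewrite /= scaleN1r.
    by apply: CkD => //; [exact: Ck_cst|apply: Ck_scaler => //; exact: Ck_id].
  pose V s := (s * (1 - s) * EL s) *: (delta_mx 0 i : 'rV[R]_n).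
  have sV : smooth_on O V by move=> k; apply: Ck_scalel.
  have V0 : V 0 = 0 by rewrite /V !mul0r scale0r.
  have V1 : V 1 = 0 by rewrite /V subrr mulr0 mul0r scale0r.
  (* The derivative of the action at 0 is now known twice, as 0 by assumption and as the integral of
     [first_variation]; comparing them gives [intE]. *)
  have [_ dI0] := dI V (ex_intro _ O (And3 oO IO sV)) V0 V1.
  have [_] := first_variation sF oO IO sx xD sV V0 V1.
  rewrite [LHS]dI0 => /esym intE.
  pose f s := s * (1 - s) * EL s ^+ 2.
  (* [V] points along the [i]-th basis vector, so only the term [j = i] survives. *)
  have fE s : \sum_j craig_synge_of (coord_expr L c) x j s * V s 0 j = f s.
    rewrite (bigD1 i)//= big1 => [|j ji].
      by rewrite addr0 !mxE !eqxx/= mulr1 /f -/(EL s); ring.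
    by rewrite !mxE (negPf ji) andbF !mulr0.
  have cf t : `[0, 1] t -> {for t, continuous f}.
    move=> /IO Ot; apply: (smooth_on_continuous _ Ot) => k.
    rewrite (_ : f = (fun s => s * (1 - s) * EL s) \* EL); first exact: CkM.
    by apply/funext => s; rewrite /f /= expr2 mulrA.
  have f0 t : `[0, 1] t -> 0 <= f t.
    rewrite /= in_itv/= => /andP[t0 t1].
    by rewrite mulr_ge0 ?sqr_ge0// mulr_ge0// subr_ge0.
  have := Rintegral_eq0_continuous cf f0.
  under eq_Rintegral do rewrite -fE.
  move=> /(_ intE) fz.
  (* In the open interval [s * (1 - s)] is nonzero and can be cancelled from [f]; continuity of [EL]
     settles the end points. *)
  apply: (continuous_eq0_itvoo_cc ltr01 (f := EL)).
    by move=> t /IO; exact: smooth_on_continuous.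
  move=> t t01; have := fz t t01; move: t01; rewrite in_itv/= => /andP[t0 t1].
  move/eqP; rewrite /f mulf_eq0 expf_eq0/= => /orP[|/eqP//].
  by rewrite mulf_eq0 subr_eq0 gt_eqF//= gt_eqF.
(* [V] is smooth on a neighbourhood of its own, whereas [first_variation] needs one common to [x]
   and [V]. *)
- pose O' := O `&` U1.
  have oO' : open O' by exact: openI.
  have IO' : `[0, 1] `<=` O' by move=> t It; split; [exact: IO|exact: IU1].
  have sx' : smooth_on O' x by move=> k; apply: Ck_subset (sx k); exact: subIsetl.
  have sV' : smooth_on O' V by move=> k; apply: Ck_subset (sV1 k); exact: subIsetr.
  have xD' t : O' t -> chart_range c (x t) by move=> [/xD].
  have := first_variation sF oO' IO' sx' xD' sV' V0 V1.
  suff -> : \int[lebesgue_measure]_(t in `[0, 1])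
      (\sum_i craig_synge_of (coord_expr L c) x i t * V t 0 i) = 0 by [].
  rewrite (@eq_Rintegral _ _ _ _ _ (cst 0)) => [|t /set_mem It].
    by rewrite Rintegral_cst// mul0r.
  by apply: big1 => i _; rewrite -[X in X * _]/(craig_synge L c x i t) CS// mul0r.
Qed.
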